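(* Let $N\ge 1$ and let $a_n<b_n$ be real numbers for $1\le n\le N^2$. Let $L=\sup_n(b_n-a_n)$. Let $\boldsymbol\tau(1),\boldsymbol\tau(2)\in\mathbb R^{N^2}$ and $\boldsymbol\xi(i)=\boldsymbol\xi(\boldsymbol\tau(i))$ for $i=1,2$, with components $\xi_n(i)=\xi_n(\tau_n(i))$. Let $$d_G^2(\boldsymbol\xi(1),\boldsymbol\xi(2))=\sum_{n=1}^{N^2}\big(k_n(\xi_n(1))-k_n(\xi_n(2))\big)^2.$$ Then $$\|\boldsymbol\xi(\boldsymbol\tau(1))-\boldsymbol\xi(\boldsymbol\tau(2))\|_2\le \frac L2\, d_G(\boldsymbol\xi(1),\boldsymbol\xi(2)),$$ $$\frac1N\|\boldsymbol\xi(\boldsymbol\tau(1))-\boldsymbol\xi(\boldsymbol\tau(2))\|_1\le \frac L2\, d_G(\boldsymbol\xi(1),\boldsymbol\xi(2)),$$ $$\sup_n|\xi_n(\tau_n(1))-\xi_n(\tau_n(2))|\le \frac L2\,\sup_n|k_n(\xi_n(1))-k_n(\xi_n(2))|.$$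
   Context: For $1\le n\le N^2$ and $\tau\in\mathbb R$ put $$\xi_n(\tau)=\frac{a_ne^{-a_n\tau}+b_ne^{-b_n\tau}}{e^{-a_n\tau}+e^{-b_n\tau}},\qquad h_n(\tau)=2\arctan\big(e^{(b_n-a_n)\tau/2}\big).$$ For $\boldsymbol\tau=(\tau_1,\dots,\tau_{N^2})$ put $\boldsymbol\xi(\boldsymbol\tau)=(\xi_n(\tau_n))_n$. The map $\xi_n:\mathbb R\to(a_n,b_n)$ has inverse $\tau_n(\xi)=\frac{1}{b_n-a_n}\ln\frac{b_n-\xi}{\xi-a_n}$, and $k_n:(a_n,b_n)\to\mathbb R$ is defined by $k_n(\xi)=h_n(\tau_n(\xi))$. $\|\cdot\|_1$ and $\|\cdot\|_2$ are the usual $\ell^1$ and $\ell^2$ norms on $\mathbb R^{N^2}$. *)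

(* Defs.v *)
From HB Require Import structures.
From mathcomp Require Import all_boot all_order all_algebra.
From mathcomp Require Import all_classical all_reals all_analysis.

Set Implicit Arguments.
Unset Strict Implicit.
Unset Printing Implicit Defensive.

Import Order.TTheory GRing.Theory Num.Theory.

Local Open Scope classical_set_scope.
Local Open Scope ring_scope.

Section Coordinate.
Context {R : realType}.

Definition xi_fun (a b tau : R) : R :=
  (a * expR (- a * tau) + b * expR (- b * tau)) /
  (expR (- a * tau) + expR (- b * tau)).

Definition h_fun (a b tau : R) : R := 2 * atan (expR ((b - a) * tau / 2)).

(* The inverse of [xi_fun a b] on the open interval ]a, b[ (for a < b). Outside
   of it the value depends on the conventions for [ln] and [^-1], so that
   [tau_fun] and [k_fun] are only meaningful on ]a, b[. *)
Definition tau_fun (a b xi : R) : R := (b - a)^-1 * ln ((b - xi) / (xi - a)).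

Definition k_fun (a b xi : R) : R := h_fun a b (tau_fun a b xi).

End Coordinate.

Section Vector.
Context {R : realType} {m : nat}.

(* MathComp-Analysis equips ['rV[R]_m] with the sup norm, hence the explicit
   l^1 and l^2 norms. *)
Definition norm1 (x : 'rV[R]_m) : R := \sum_(n < m) `|x ord0 n|.

Definition norm2 (x : 'rV[R]_m) : R :=
  Num.sqrt (\sum_(n < m) (x ord0 n) ^+ 2).

Definition xi_vec (a b tau : 'rV[R]_m) : 'rV[R]_m :=
  \row_(n < m) xi_fun (a ord0 n) (b ord0 n) (tau ord0 n).

Definition d_G (a b xi1 xi2 : 'rV[R]_m) : R :=
  Num.sqrt (\sum_(n < m)
    (k_fun (a ord0 n) (b ord0 n) (xi1 ord0 n) -
     k_fun (a ord0 n) (b ord0 n) (xi2 ord0 n)) ^+ 2).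

End Vector.

(* Main.v *)
(* With h = h_fun a b tau one has cos h = 2 / (1 + exp ((b - a) tau)) - 1, so
   xi_fun a b tau = (a + b) / 2 + (b - a) / 2 * cos h: in the coordinate k = h,
   xi runs over a half circle of diameter b - a and is (b - a) / 2-Lipschitz.
   The l^1 bound then costs a Cauchy-Schwarz factor sqrt (N ^ 2) = N. *)
Require Import Defs.
From mathcomp Require Import all_boot all_order all_algebra.
From mathcomp Require Import all_classical all_reals all_analysis.
From mathcomp Require Import ring lra.

Import Order.TTheory GRing.Theory Num.Theory.
Import numFieldNormedType.Exports.

Local Open Scope classical_set_scope.
Local Open Scope ring_scope.

(** Mean value theorem: the derivative [- sin] is bounded by 1 in absolute value. *)
Lemma cos_lipschitz (R : realType) (x y : R) : `|cos x - cos y| <= `|x - y|.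
Proof.
wlog le_yx : x y / y <= x => [H|].
  have [/H//|/ltW/H] := leP y x.
  by rewrite distrC (distrC y).
have dcos (z : R) : z \in `]y, x[ -> is_derive z 1 cos (- sin z).
  by move=> _; exact: is_derive_cos.
have ccos : {within `[y, x], continuous (@cos R)}.
  by apply: continuous_subspaceT => z; exact: continuous_cos.
have [c _ ->] := MVT_segment le_yx dcos ccos.
rewrite normrM -[leRHS]mul1r ler_wpM2r// normrN ler_norml.
by rewrite sin_geN1 sin_le1.
Qed.

Lemma xi_fun_cos (R : realType) (a b t : R) :
  xi_fun a b t = (a + b) / 2 + (b - a) / 2 * cos (h_fun a b t).
Proof.
rewrite /h_fun mulr_natl cos_mulr2n cos_atan exprVn sqr_sqrtr; last first.
  by rewrite addr_ge0// sqr_ge0.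
(* In terms of the two exponential weights both sides become rational functions, within reach of
   [field]. *)
have -> : expR ((b - a) * t / 2) ^+ 2 = expR (- a * t) / expR (- b * t).
  by rewrite expr2 -expRN -!expRD; congr expR; field.
rewrite /xi_fun.
have p0 := expR_gt0 (- a * t); have q0 := expR_gt0 (- b * t).
by field; rewrite !gt_eqF ?addr_gt0.
Qed.

(** With weights [p = expR (- a * t)] and [q = expR (- b * t)], [b - xi = (b - a) p / (p + q)] and
    [xi - a = (b - a) q / (p + q)], so the logarithm is that of [p / q], namely [(b - a) t]. *)
Lemma xi_funK (R : realType) (a b : R) :
  a < b -> cancel (xi_fun a b) (tau_fun a b).
Proof.
move=> ltab t; have ba0 : b - a != 0 by rewrite subr_eq0 gt_eqF.
have -> : tau_fun a b (xi_fun a b t) =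
    (b - a)^-1 * ln (expR (- a * t) / expR (- b * t)).
  rewrite /tau_fun /xi_fun; congr (_ * ln _).
  have := expR_gt0 (- a * t); have := expR_gt0 (- b * t).
  set q := expR (- b * t); set p := expR (- a * t) => q0 p0.
  have pq0 : p + q != 0 by rewrite gt_eqF// addr_gt0.
  field; rewrite pq0 (gt_eqF q0)/=.
  (* The remaining side condition is that the numerator of [xi - a] does not vanish. *)
  rewrite (_ : _ + _ = (b - a) * q); last by ring.
  by rewrite mulf_neq0// gt_eqF.
rewrite -expRN -expRD expRK; field.
by [].
Qed.

(** By [xi_funK], [k_fun] at [xi_fun a b t] is [h_fun a b t]; the cosine formula then reduces the
    bound to [cos_lipschitz]. *)
Lemma xi_fun_dist_le (R : realType) (a b t1 t2 : R) : a < b ->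
  `|xi_fun a b t1 - xi_fun a b t2| <=
  (b - a) / 2 * `|k_fun a b (xi_fun a b t1) - k_fun a b (xi_fun a b t2)|.
Proof.
move=> ltab; rewrite /k_fun !xi_funK// !xi_fun_cos opprD addrACA subrr add0r.
have ba0 : 0 <= (b - a) / 2 by rewrite divr_ge0// subr_ge0 ltW.
by rewrite -mulrBr normrM ger0_norm// ler_wpM2l// cos_lipschitz.
Qed.

Lemma norm2_le_scale (R : realType) (m : nat) (c : R) (x y : 'rV[R]_m) :
  0 <= c -> (forall n, `|x ord0 n| <= c * `|y ord0 n|) ->
  norm2 x <= c * norm2 y.
Proof.
move=> c0 lexy; rewrite /norm2 -{1}(ger0_norm c0) -sqrtr_sqr -sqrtrM ?sqr_ge0//.
rewrite ler_wsqrtr// mulr_sumr ler_sum// => n _.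
rewrite -exprMn -real_normK ?num_real// -[leRHS]real_normK ?num_real//.
by rewrite lerXn2r ?nnegrE// normrM (ger0_norm c0).
Qed.

Lemma norm1_le_norm2 (R : realType) (m : nat) (x : 'rV[R]_m) :
  norm1 x <= Num.sqrt m%:R * norm2 x.
Proof.
have s0 : 0 <= norm1 x by apply: sumr_ge0.
rewrite -(ger0_norm s0) -sqrtr_sqr /norm2 -sqrtrM// ler_wsqrtr//.
rewrite /norm1 expr2 big_distrlr/=.
(* |x_i| |x_j| <= (x_i^2 + x_j^2) / 2, summed over all pairs. *)
apply: (@le_trans _ _
    (\sum_(i < m) \sum_(j < m) (x ord0 i ^+ 2 + x ord0 j ^+ 2) / 2)).
  apply: ler_sum => i _; apply: ler_sum => j _.
  rewrite -(real_normK (num_real (x ord0 i))).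
  rewrite -(real_normK (num_real (x ord0 j))).
  by have := sqr_ge0 (`|x ord0 i| - `|x ord0 j|); nra.
(* Each of the two squares contributes [m / 2] times the sum of squares. *)
under [leLHS]eq_bigr => i _ do
  rewrite -mulr_suml big_split/= sumr_const card_ord.
by rewrite -mulr_suml big_split/= sumr_const card_ord sumrMnl -(mulr_natl _ m); lra.
Qed.

(** A real [sup] dominates its set only if the set is bounded above; here the sum of the [|F n|] is
    a bound. *)
Lemma le_sup_fin (R : realType) (I : finType) (F : I -> R) (i : I) :
  F i <= sup [set F n | n in [set: I]].
Proof.
apply: ub_le_sup; last by exists i.
exists (\sum_n `|F n|) => _ [n _ <-].
by rewrite (bigD1 n)//= (le_trans (ler_norm _))// lerDl sumr_ge0.
Qed.

Theorem theorem3p3 (R : realType) (N : nat) (hN : (1 <= N)%N)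
    (a b : 'rV[R]_(N ^ 2)%N)
    (hab : forall n : 'I_(N ^ 2)%N, a ord0 n < b ord0 n)
    (tau1 tau2 : 'rV[R]_(N ^ 2)%N) :
  let L : R := sup [set b ord0 n - a ord0 n | n in [set: 'I_(N ^ 2)%N]] in
  let xi1 := xi_vec a b tau1 in
  let xi2 := xi_vec a b tau2 in
  [/\ norm2 (xi1 - xi2) <= L / 2 * d_G a b xi1 xi2,
      N%:R^-1 * norm1 (xi1 - xi2) <= L / 2 * d_G a b xi1 xi2
    & sup [set `|xi1 ord0 n - xi2 ord0 n| | n in [set: 'I_(N ^ 2)%N]] <=
      L / 2 *
      sup [set `|k_fun (a ord0 n) (b ord0 n) (xi1 ord0 n) -
                 k_fun (a ord0 n) (b ord0 n) (xi2 ord0 n)|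
          | n in [set: 'I_(N ^ 2)%N]]].
Proof.
move=> L xi1 xi2.
have N2_gt0 : (0 < N ^ 2)%N by rewrite expn_gt0 hN.
(* An index exists since [N >= 1]; it gives [0 <= L] and the nonemptiness needed to bound the last
   supremum. *)
pose n0 := Ordinal N2_gt0.
have leL n : b ord0 n - a ord0 n <= L.
  exact: (le_sup_fin _ _ (fun n => b ord0 n - a ord0 n)).
have L2_ge0 : 0 <= L / 2.
  by rewrite divr_ge0// (le_trans _ (leL n0))// subr_ge0 ltW.
pose k (xi : 'rV[R]_(N ^ 2)) : 'rV[R]_(N ^ 2) :=
  \row_n k_fun (a ord0 n) (b ord0 n) (xi ord0 n).
have subE (x y : 'rV[R]_(N ^ 2)) n : (x - y) ord0 n = x ord0 n - y ord0 n.
  by rewrite !mxE.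
have kE x n : k x ord0 n = k_fun (a ord0 n) (b ord0 n) (x ord0 n).
  by rewrite mxE.
(* All three estimates come from this coordinatewise bound, with [b - a] enlarged to the uniform
   [L]. *)
have le_coord n : `|xi1 ord0 n - xi2 ord0 n| <=
    L / 2 * `|k_fun (a ord0 n) (b ord0 n) (xi1 ord0 n) -
              k_fun (a ord0 n) (b ord0 n) (xi2 ord0 n)|.
  rewrite !mxE (le_trans (xi_fun_dist_le _ _ _ _ _ (hab n)))//.
  by rewrite ler_wpM2r// ler_pM2r.
have dGE : d_G a b xi1 xi2 = norm2 (k xi1 - k xi2).
  by congr Num.sqrt; apply: eq_bigr => n _; rewrite subE !kE.
have le2 : norm2 (xi1 - xi2) <= L / 2 * d_G a b xi1 xi2.
  by rewrite dGE norm2_le_scale// => n; rewrite !subE !kE.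
split=> //.
- apply: le_trans le2; rewrite ler_pdivrMl ?ltr0n//.
  by rewrite (le_trans (norm1_le_norm2 _ _ _))// natrX sqrtr_sqr ger0_norm.
- apply: ge_sup => [|_ [n _ <-]].
    by exists `|xi1 ord0 n0 - xi2 ord0 n0|; exists n0.
  apply: le_trans (le_coord n) _; apply: ler_wpM2l => //.
  exact: (le_sup_fin _ _ (fun n => `|k_fun (a ord0 n) (b ord0 n) (xi1 ord0 n) -
                                 k_fun (a ord0 n) (b ord0 n) (xi2 ord0 n)|)).
Qed.
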